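(* Let $\mathfrak P=(P_n)_{n\ge0}$ be a subfactor planar algebra and $k\ge 0$. Let $X$ be the linear endomorphism of $\bigoplus_{n\ge 0}P_{n+k}$ given by the sum of all epi Temperley-Lieb diagrams, and let $\langle\cdot,\cdot\rangle$ and $\langle\langle\cdot,\cdot\rangle\rangle$ be the two inner products on $\bigoplus_{n\ge 0}P_{n+k}$ defined in the context. Then $\langle\langle a,b\rangle\rangle=\langle X(a),X(b)\rangle$ for all $a,b\in\bigoplus_{n\ge 0}P_{n+k}$.
   Context: $\mathfrak P=(P_n)_{n\ge 0}$ is a subfactor planar algebra with closed loops equal to $\delta>0$; elements of $P_n$ label discs with $2n$ boundary points. Write $P_{n,k}=P_{n+k}$ for the $n$-th summand of $\bigoplus_{n\ge 0}P_{n+k}$ (algebraic direct sum); an element of $P_{n,k}$ is drawn as a box with $k$ strings on the left, $k$ on the right, $2n$ strings on top, none at the bottom, with distinguished interval at the top left corner. The involution $*$ on $P_{n,k}$ is the planar algebra involution, drawn by reflecting the box in a vertical line (so left and right are exchanged, top strings are reversed, and the distinguished interval is again taken at the top left). Inner product $\langle\cdot,\cdot\rangle$: the $P_{n,k}$ are mutually orthogonal, and for $a,b\in P_{n,k}$, $\langle a,b\rangle$ is $\delta^{-k}$ times the scalar value of the closed diagram obtained by placing $a$ to the left of $b^*$, joining the $k$ right strings of $a$ to the $k$ left strings of $b^*$, joining the $2n$ top strings of $a$ to the $2n$ top strings of $b^*$ by $2n$ nested arcs, and closing the remaining $k$ left strings of $a$ to the $k$ right strings of $b^*$ by parallel arcs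 passing below. Inner product $\langle\langle\cdot,\cdot\rangle\rangle$: for $a\in P_{m,k}$, $b\in P_{n,k}$, $\langle\langle a,b\rangle\rangle$ is $\delta^{-k}$ times the scalar obtained by placing $a$ to the left of $b^*$, joining the $k$ right strings of $a$ to the $k$ left strings of $b^*$, closing the remaining $k$ left strings of $a$ to the $k$ right strings of $b^*$ by parallel arcs passing below, and attaching to the $2(m+n)$ top strings of $a$ and $b^*$ the sum $\Sigma TL$ of all loopless Temperley-Lieb diagrams on $2(m+n)$ boundary points (all planar pairings). Both forms are extended sesquilinearly. The map $X$. A Temperley-Lieb (TL) diagram is a loopless planar pairing, up to isotopy, of boundary points on the bottom (incoming) and top (outgoing) sides of a rectangle. A TL diagram with $2i$ points on the bottom and $2j$ points on top is regarded as a linear map $P_{i,k}\to P_{j,k}$, by attaching its bottom points to the $2i$ top strings of an element of $P_{i,k}$. A TL diagram is epi if each point on its top side is connected to a point on its bottom side. The block $P_{i,k}\to P_{j,k}$ of $X$ is the finite sum of all epi TL diagrams from $2i$ points to $2j$ points (the identity if $i=j$, zero if $i<j$). *)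

(* Defs.v *)
From HB Require Import structures.
From mathcomp Require Import all_boot all_order all_algebra.
From mathcomp Require Import boolp classical_sets functions cardinality fsbigop.

Set Implicit Arguments.
Unset Strict Implicit.
Unset Printing Implicit Defensive.

Import Order.TTheory GRing.Theory Num.Theory.
Local Open Scope ring_scope.

(* Labelled planar tangles up to isotopy, in Morse position.

   The outer disc is a rectangle with all its marked points on the top side, so
   its distinguished interval consists of the left, bottom and right sides; the
   inner discs are isotoped to boxes of the same shape.  Marked points are
   therefore read clockwise from the distinguished interval, i.e. left to right.
   A tangle is the list, from bottom to top, of its critical levels: minima,
   maxima and boxes; the position of a level is the number of strings running to
   its left.  Strings are checkerboard shaded, [true] meaning shaded, and the
   sign [s] of a box space or of a tangle is the shading of the region next to
   its distinguished interval.  The label of a box in sign [s] with [2n] marked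
   points is an element of [V s n]. *)

Inductive level (V : bool -> nat -> Type) : Type :=
| Cup
| Cap
| Box (s : bool) (n : nat) (x : V s n).
Arguments Cup {V}.
Arguments Cap {V}.
Arguments Box {V s n} x.

Section Words.
Variable V : bool -> nat -> Type.

Definition ins (e : level V) : nat := if e is Cap then 2 else 0.

Definition outs (e : level V) : nat :=
  match e with Cup => 2 | Cap => 0 | Box _ n _ => n.*2 end.

Definition word := seq (level V * nat).

Definition shading_ok (s : bool) (e : level V) (i : nat) : bool :=
  if e is Box t _ _ then t == s (+) odd i else true.

(* [w] is a legal stack of levels, from [m] strings below to [n] strings above,
   where [s] is the shading of the leftmost region. *)
Fixpoint stack (s : bool) (m : nat) (w : word) (n : nat) : bool :=
  if w is (e, i) :: w' then
    [&& (i + ins e <= m)%N, shading_ok s e i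
      & stack s (m - ins e + outs e) w' n]
  else m == n.

Definition tangle (s : bool) (n : nat) (w : word) : bool := stack s 0 w n.*2.

Definition shift (i : nat) (w : word) : word :=
  [seq (ei.1, (i + ei.2)%N) | ei <- w].

(* [ncups i p] creates the [2p] strings at positions [i, ..., i+2p-1], and
   [ncaps i p] closes them, in both cases by [p] nested arcs. *)
Definition ncups (i p : nat) : word := [seq (Cup, (i + j)%N) | j <- iota 0 p].
Definition ncaps (i p : nat) : word :=
  [seq (Cap, (i + j)%N) | j <- rev (iota 0 p)].

(* A box with [q] strings on top and [p] strings at the bottom, the distinguished
   interval being its left side: the last [p] strings, going clockwise, are bent
   down.  It is glued on the [p] strings at positions [i, ..., i+p-1]. *)
Definition bent_box s n (x : V s n) (i p q : nat) : word :=
  (Box x, i) :: ncaps (i + q) p.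

(* Elementary isotopies: change of relative height of two levels side by side,
   straightening of a string, and rotation of an inner disc by a full turn. *)
Inductive isotopy : word -> word -> Prop :=
| Iso_exchange (e f : level V) (i k : nat) :
    isotopy [:: (e, i); (f, (i + outs e + k)%N)]
            [:: (f, (i + ins e + k)%N); (e, i)]
| Iso_zigzag_right (i : nat) : isotopy [:: (Cup, i); (Cap, i.+1)] [::]
| Iso_zigzag_left (i : nat) : isotopy [:: (Cup, i.+1); (Cap, i)] [::]
| Iso_turn s n (x : V s n) (i : nat) :
    isotopy [:: (Box x, i)]
      (ncups i n.*2 ++ (Box x, (i + n.*2)%N) :: ncaps (i + n.*2) n.*2).

(* Reflection in a vertical line of a word starting from [m] strings. *)
Definition mirror_level (star : forall s n, V s n -> V s n) (e : level V) :
    level V :=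
  if e is Box _ _ x then Box (star _ _ x) else e.

Fixpoint mirror (star : forall s n, V s n -> V s n) (m : nat) (w : word) :
    word :=
  if w is (e, i) :: w' then
    (mirror_level star e, (m - ins e - i)%N)
      :: mirror star (m - ins e + outs e) w'
  else [::].

End Words.
Arguments ncups {V} i p.
Arguments ncaps {V} i p.

Section PlanarAlgebras.
Variable C : numClosedFieldType.

(* [Z s n w] is the element of [box s n] obtained by letting the tangle
   underlying [w] act on the labels of [w]; only its values on the words with
   [tangle s n w] are meaningful.  [Z_subst] is compatibility with composition
   of tangles. *)
Record planar_algebra := PlanarAlgebra {
  box : bool -> nat -> vectType C;
  Z : forall (s : bool) (n : nat), word box -> box s n;
  Z_default : forall s n w, ~~ tangle s n w -> Z s n w = 0;
  Z_linear : forall s n (w1 w2 : word box) i t m (c : C) (x y : box t m),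
    Z s n (w1 ++ (Box (c *: x + y), i) :: w2) =
    c *: Z s n (w1 ++ (Box x, i) :: w2) + Z s n (w1 ++ (Box y, i) :: w2);
  Z_isotopy : forall s n (w1 w2 v v' : word box), isotopy v v' ->
    tangle s n (w1 ++ v ++ w2) -> tangle s n (w1 ++ v' ++ w2) ->
    Z s n (w1 ++ v ++ w2) = Z s n (w1 ++ v' ++ w2);
  Z_box : forall s n (x : box s n), Z s n [:: (Box x, 0%N)] = x;
  Z_subst : forall s n (w1 w2 v : word box) i t m, tangle t m v ->
    tangle s n (w1 ++ (Box (Z t m v), i) :: w2) ->
    Z s n (w1 ++ (Box (Z t m v), i) :: w2) = Z s n (w1 ++ shift i v ++ w2)
}.

(* The scalar of an element of a one-dimensional space of closed diagrams: its
   coordinate with respect to the empty diagram. *)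
Definition scalar (P : planar_algebra) (s : bool) (x : box P s 0) : C :=
  coord [tuple Z s 0 [::]] ord0 x.

(* [sphericity] says that moving the outer string of a closed diagram across the
   point at infinity of the sphere does not change its scalar. *)
Record subfactor_planar_algebra := SubfactorPlanarAlgebra {
  pa :> planar_algebra;
  star : forall s n, box pa s n -> box pa s n;
  star_antilinear : forall s n (c : C) (x y : box pa s n),
    star (c *: x + y) = c^* *: star x + star y;
  starK : forall s n, involutive (@star s n);
  star_Z : forall s n (w : word (box pa)), tangle s n w ->
    star (Z s n w) = Z s n (mirror star 0 w);
  dim_box0 : forall s, \dim {: box pa s 0} = 1%N;
  sphericity : forall s (x : box pa s 1),
    scalar (Z s 0 [:: (Box x, 0%N); (Cap, 0%N)]) =
    scalar (Z (~~ s) 0 [:: (Cup, 0%N); (Box x, 1%N); (Cap, 0%N); (Cap, 0%N)]);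
  positivity : forall s n (x : box pa s n), x != 0 ->
    0 < scalar (Z s 0 ((Box x, 0%N) :: (Box (star x), n.*2) :: ncaps 0 n.*2));
  delta : C;
  delta_gt0 : 0 < delta;
  loop_delta : forall s, scalar (P := pa) (Z s 0 [:: (Cup, 0%N); (Cap, 0%N)]) = delta
}.

End PlanarAlgebras.

(* Loopless planar pairings of [m] bottom points, [inl], and [n] top points,
   [inr], both numbered from left to right. *)
Section TemperleyLieb.
Variables m n : nat.

(* The boundary of the rectangle, starting at the bottom left corner and going
   along the bottom side, then back along the top side. *)
Definition boundary_pos (x : 'I_m + 'I_n) : nat :=
  match x with inl b => b | inr t => (m + (n - t.+1))%N end.

Definition planar_pairing (f : {ffun 'I_m + 'I_n -> 'I_m + 'I_n}) : bool :=
  [forall x, (f x != x) && (f (f x) == x)] &&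
  [forall x, forall y,
     ~~ [&& (boundary_pos x < boundary_pos y)%N,
            (boundary_pos y < boundary_pos (f x))%N
          & (boundary_pos (f x) < boundary_pos (f y))%N]].

Definition TL := {f : {ffun 'I_m + 'I_n -> 'I_m + 'I_n} | planar_pairing f}.

Definition epi (f : TL) : bool :=
  [forall t : 'I_n, exists b : 'I_m, val f (inr t) == inl b].

Definition bottom_arc (f : TL) (b : 'I_m) : option 'I_m :=
  if val f (inl b) is inl b' then Some b' else None.

Definition top_arc (f : TL) (t : 'I_n) : option 'I_n :=
  if val f (inr t) is inr t' then Some t' else None.

End TemperleyLieb.

(* [g r = Some l] when [r] and [l] are joined by an arc on the same side, and
   [g r = None] when [r] is the end of a through string.  The arcs are listed by
   increasing right end, so that each one is closed after those nested in it;
   when the arc from [l] to [r] is closed, the strings on its left are the points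
   [p < l] that are not on an arc with right end before [r]. *)
Definition arc_positions (m : nat) (g : 'I_m -> option 'I_m) : seq nat :=
  pmap (fun r : 'I_m =>
    if g r is Some l then
      if (l < r)%N then
        Some #|[pred p : 'I_m | (p < l)%N &&
                 (if g p is Some q then (r < q)%N else true)]|
      else None
    else None) (enum 'I_m).

(* The pairing as a stack of levels: its bottom arcs are maxima, its top arcs
   are minima, listed in the opposite order. *)
Definition TL_word (V : bool -> nat -> Type) (m n : nat) (f : TL m n) : word V :=
  [seq (Cap, i) | i <- arc_positions (bottom_arc f)] ++
  [seq (Cup, i) | i <- rev (arc_positions (top_arc f))].

(* The algebraic direct sum of a sequence of modules. *)
Section DirectSum.
Variables (C : nzRingType) (V : nat -> lmodType C).

Record dsum := DSum {
  summand :> forall n, V n;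
  dsum_finite : exists N : nat, forall n, (N <= n)%N -> summand n = 0
}.

Lemma dsum_eqP (a b : dsum) : (forall n, a n = b n) -> a = b.
Proof.
case: a b => [a ha] [b hb] /= ab.
have {}ab : a = b by exact: functional_extensionality_dep.
by case: _ / ab in hb *; congr DSum; exact: Prop_irrelevance.
Qed.

HB.instance Definition _ := gen_eqMixin dsum.
HB.instance Definition _ := gen_choiceMixin dsum.

Fact dsum_zero_finite :
  exists N : nat, forall n, (N <= n)%N -> (0 : V n) = 0.
Proof. by exists 0%N. Qed.
Definition dsum_zero : dsum := DSum dsum_zero_finite.

Fact dsum_opp_finite (a : dsum) :
  exists N : nat, forall n, (N <= n)%N -> - a n = 0.
Proof. by case: (dsum_finite a) => N aN; exists N => n /aN ->; rewrite oppr0. Qed.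
Definition dsum_opp (a : dsum) : dsum := DSum (dsum_opp_finite a).

Fact dsum_add_finite (a b : dsum) :
  exists N : nat, forall n, (N <= n)%N -> a n + b n = 0.
Proof.
have [N aN] := dsum_finite a; have [M bM] := dsum_finite b.
by exists (maxn N M) => n; rewrite geq_max => /andP[/aN -> /bM ->]; rewrite addr0.
Qed.
Definition dsum_add (a b : dsum) : dsum := DSum (dsum_add_finite a b).

Fact dsum_scale_finite (c : C) (a : dsum) :
  exists N : nat, forall n, (N <= n)%N -> c *: a n = 0.
Proof. by case: (dsum_finite a) => N aN; exists N => n /aN ->; rewrite scaler0. Qed.
Definition dsum_scale (c : C) (a : dsum) : dsum := DSum (dsum_scale_finite c a).

Fact dsum_addA : associative dsum_add.
Proof. by move=> a b c; apply: dsum_eqP => n /=; rewrite addrA. Qed.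
Fact dsum_addC : commutative dsum_add.
Proof. by move=> a b; apply: dsum_eqP => n /=; rewrite addrC. Qed.
Fact dsum_add0 : left_id dsum_zero dsum_add.
Proof. by move=> a; apply: dsum_eqP => n /=; rewrite add0r. Qed.
Fact dsum_addN : left_inverse dsum_zero dsum_opp dsum_add.
Proof. by move=> a; apply: dsum_eqP => n /=; rewrite addNr. Qed.

HB.instance Definition _ :=
  GRing.isZmodule.Build dsum dsum_addA dsum_addC dsum_add0 dsum_addN.

Fact dsum_scaleA (c d : C) (a : dsum) :
  dsum_scale c (dsum_scale d a) = dsum_scale (c * d) a.
Proof. by apply: dsum_eqP => n /=; rewrite scalerA. Qed.
Fact dsum_scale1 : left_id 1 dsum_scale.
Proof. by move=> a; apply: dsum_eqP => n /=; rewrite scale1r. Qed.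
Fact dsum_scaleDr : right_distributive dsum_scale +%R.
Proof. by move=> c a b; apply: dsum_eqP => n /=; rewrite scalerDr. Qed.
Fact dsum_scaleDl (a : dsum) :
  {morph dsum_scale^~ a : c d / c + d}.
Proof. by move=> c d; apply: dsum_eqP => n /=; rewrite scalerDl. Qed.

HB.instance Definition _ := GRing.Zmodule_isLmodule.Build C dsum
  dsum_scaleA dsum_scale1 dsum_scaleDr dsum_scaleDl.

End DirectSum.

Lemma fsum_bounded (W : zmodType) (F : nat -> W) (N : nat) :
  (forall i, (N <= i)%N -> F i = 0) ->
  \sum_(i \in [set: nat]) F i = \sum_(i < N) F i.
Proof.
move=> F0; rewrite fsbig_ord; apply/esym/fsbig_widen => // i [_ /=] /negP.
by rewrite -leqNgt => /F0.
Qed.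

Section GradedInnerProducts.
Variables (C : numClosedFieldType) (P : subfactor_planar_algebra C) (k : nat).

(* The summand [P_{n,k} = P_{n+k}] of sign unshaded.  Going clockwise from the
   top left corner, the marked points of [x] are its [2n] top strings, its [k]
   right strings from top to bottom and its [k] left strings from bottom to
   top. *)
Definition P_ (n : nat) : vectType C := box P false (n + k).

Notation Gr := (dsum P_).

(* The reflected box is labelled by [star x] with its distinguished interval at
   the top right corner; it is put back at the top left corner, where the last
   [2n] points of [star x] become the top strings. *)
Definition starP (n : nat) (x : P_ n) : P_ n :=
  Z false (n + k) (ncups 0 n.*2 ++ bent_box (star x) n.*2 n.*2 k.*2).

(* The box [x] to the left of the box [y], with their left and right strings bent
   down (from left to right: left strings from top to bottom, then right strings
   from bottom to top).  The inner [k] cups join the right strings of [x] to the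
   left strings of [y]; the outer [k] join the left strings of [x] to the right
   strings of [y], passing below.  The [2(m+n)] top strings are left open. *)
Definition side_by_side m n (x : P_ m) (y : P_ n) : word (box P) :=
  ncups 0 k.*2 ++ bent_box x 0 k.*2 m.*2 ++ bent_box y m.*2 k.*2 n.*2.

Definition ip_ n (x y : P_ n) : C :=
  (delta P) ^- k * scalar (Z false 0 (side_by_side x (starP y) ++ ncaps 0 n.*2)).

Definition ip (a b : Gr) : C := \sum_(n \in [set: nat]) ip_ (a n) (b n).

Definition iip_ m n (x : P_ m) (y : P_ n) : C :=
  (delta P) ^- k * \sum_(f : TL (m + n).*2 0)
     scalar (Z false 0 (side_by_side x (starP y) ++ TL_word _ f)).

Definition iip (a b : Gr) : C :=
  \sum_(m \in [set: nat]) \sum_(n \in [set: nat]) iip_ (a m) (b n).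

Definition TL_map i j (f : TL i.*2 j.*2) (x : P_ i) : P_ j :=
  Z false (j + k) ((Box x, 0%N) :: TL_word _ f).

Definition X_block i j (x : P_ i) : P_ j :=
  \sum_(f : TL i.*2 j.*2 | epi f) TL_map f x.

Lemma X_block_linear i j : linear (@X_block i j : P_ i -> P_ j).
Proof.
move=> c x y; rewrite /X_block scaler_sumr -big_split /=.
by apply: eq_bigr => f _; rewrite /TL_map (Z_linear false (j + k) [::]).
Qed.

Lemma X_block0 i j : X_block j (0 : P_ i) = 0.
Proof.
have := @X_block_linear i j (-1) 0 0.
by rewrite scaler0 addr0 scaleN1r addNr.
Qed.

Lemma epi_leq m n (f : TL m n) : epi f -> (n <= m)%N.
Proof.
move=> /forallP epif; have /andP[/forallP fK _] := valP f.
pose g (t : 'I_n) : 'I_m := xchoose (existsP (epif t)).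
have gE t : val f (inr t) = inl (g t) by apply/eqP/(xchooseP (existsP (epif t))).
have inj_g : injective g.
  move=> t u tu; have /andP[_ /eqP ft] := fK (inr t); have /andP[_ /eqP fu] := fK (inr u).
  by have [] : inr t = inr u :> 'I_m + 'I_n by rewrite -ft -fu !gE tu.
by rewrite -(card_ord n) -(card_ord m); exact: leq_card inj_g.
Qed.

Lemma X_block_lt i j (x : P_ i) : (i < j)%N -> X_block j x = 0.
Proof.
move=> ij; rewrite /X_block big1 // => f /epi_leq.
by rewrite leq_double leqNgt ij.
Qed.

Definition X_summand (a : Gr) (j : nat) : P_ j :=
  \sum_(i \in [set: nat]) X_block j (a i).

Fact X_finite (a : Gr) :
  exists N : nat, forall j, (N <= j)%N -> X_summand a j = 0.
Proof.
have [N aN] := dsum_finite a; exists N => j Nj.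
rewrite /X_summand fsbig1 // => i _.
have [Ni|iN] := leqP N i; first by rewrite aN // X_block0.
by rewrite X_block_lt // (leq_trans iN).
Qed.

Definition X (a : Gr) : Gr := DSum (X_finite a).

Fact X_linear : linear X.
Proof.
move=> c a b; apply: dsum_eqP => j /=.
have [N aN] := dsum_finite a; have [M bM] := dsum_finite b.
rewrite /X_summand !(@fsum_bounded _ _ (maxn N M)).
- rewrite scaler_sumr -big_split; apply: eq_bigr => i _ /=.
  exact: X_block_linear.
- by move=> i; rewrite geq_max => /andP[_ /bM ->]; rewrite X_block0.
- by move=> i; rewrite geq_max => /andP[/aN -> _]; rewrite X_block0.
- move=> i; rewrite geq_max => /andP[iN iM] /=.
  by rewrite aN // bM // scaler0 addr0 X_block0.
Qed.

HB.instance Definition _ := GRing.isLinear.Build C Gr Gr *:%R X X_linear.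

End GradedInnerProducts.

(* Main.v *)
Require Import Defs.
From mathcomp Require Import all_boot all_order all_algebra.
From mathcomp Require Import reals complex zify.

(* A planar pairing of 2m + 2n points is the same as two epi TL diagrams, from 2m
   and from 2n points to the same number of points, glued along their through
   strings by nested arcs: cut the pairing between the two groups of points.

   An epi diagram is determined by the ballot sequence telling which bottom
   points are right ends of arcs, and it is a word of caps whose positions are
   read off the heights of that sequence.  Summing over ballot sequences, moving
   the last of the a + 1 left points to the front of the b right ones does not
   change the sum over glued pairs: a last point that is a through string becomes
   a first point that is a through string or is capped, and conversely.  Hence
   the sum over glued pairs of (a, b) points is that of (a + b, 0) points, which
   is the sum over all pairings.

   Pictures are compared in all contexts with a fixed number of strings below;
   only the exchange of distant levels and, to reflect an epi diagram with
   [starP], the straightening of strings are used. *)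

Set Implicit Arguments.
Unset Strict Implicit.
Unset Printing Implicit Defensive.

Import Order.TTheory GRing.Theory Num.Theory.
Local Open Scope ring_scope.

(** * Words of levels *)

Section Heights.
Variable V : bool -> nat -> Type.
Implicit Types (w u v : word V) (e f : level V).
Local Open Scope nat_scope.

(** Defined on every word, by truncated subtraction, so that it also makes sense for the arbitrary
    contexts in [weq]; on legal words it is the number of strings on top. *)
Definition height (m : nat) w : nat :=
  foldl (fun h ei => h - ins ei.1 + outs ei.1) m w.

(** The part of [stack] that does not depend on the shading. *)
Fixpoint fits (m : nat) w (n : nat) : bool :=
  if w is (e, i) :: w' then
    (i + ins e <= m) && fits (m - ins e + outs e) w' n
  else m == n.

Lemma stackE s m w n :
  stack s m w n = fits m w n && all (fun ei => shading_ok s ei.1 ei.2) w.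
Proof.
elim: w m => [|[e i] w IHw] m /=; first by rewrite andbT.
by rewrite IHw; case: (_ <= _); case: (shading_ok _ _ _); rewrite ?andbF.
Qed.

Lemma fits_height m w n : fits m w n -> height m w = n.
Proof. by elim: w m => [|[e i] w IHw] m /=; [move/eqP | case/andP=> _ /IHw]. Qed.

Lemma height_cat m w1 w2 : height m (w1 ++ w2) = height (height m w1) w2.
Proof. exact: foldl_cat. Qed.

Lemma fits_cat m w1 w2 n :
  fits m (w1 ++ w2) n = fits m w1 (height m w1) && fits (height m w1) w2 n.
Proof.
by elim: w1 m => [|[e i] w1 IHw] m /=; rewrite ?eqxx // IHw andbA.
Qed.

Lemma stack_cat s m w1 w2 n :
  stack s m (w1 ++ w2) n =
  stack s m w1 (height m w1) && stack s (height m w1) w2 n.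
Proof. by rewrite !stackE fits_cat all_cat andbACA. Qed.

Lemma fits_trans m n p w1 w2 : fits m w1 n -> fits n w2 p -> fits m (w1 ++ w2) p.
Proof. by move=> f1 f2; rewrite fits_cat (fits_height f1) f1. Qed.

Lemma shift_cat i w1 w2 : shift i (w1 ++ w2) = shift i w1 ++ shift i w2.
Proof. exact: map_cat. Qed.

Lemma shift0 w : shift 0 w = w.
Proof. by rewrite /shift -[RHS]map_id; apply: eq_map => -[]. Qed.

(** Of the [d] strings added beside [w], [i] stand on its left and [d - i] on its right. *)
Lemma fits_shift d i m w n :
  i <= d -> fits m w n -> fits (d + m) (shift i w) (d + n).
Proof.
move=> id; elim: w m => [|[e j] w IHw] m /=; first by move/eqP->.
move=> /andP[jm /IHw].
rewrite (_ : d + _ = d + m - ins e + outs e); last by lia.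
by move=> ->; rewrite andbT; lia.
Qed.

Lemma shading_ok_odd s e i j : odd i = odd j -> shading_ok s e i = shading_ok s e j.
Proof. by move=> ij; case: e => //= t n x; rewrite ij. Qed.

Lemma odd_ins e : odd (ins e) = false. Proof. by case: e. Qed.
Lemma odd_outs e : odd (outs e) = false.
Proof. by case: e => //= *; exact: odd_double. Qed.

Lemma ncapsS i p : ncaps i p.+1 = (Cap, i + p) :: ncaps i p :> word V.
Proof. by rewrite /ncaps -[in LHS]addn1 iotaD rev_cat. Qed.

Lemma ncupsS i p : ncups i p.+1 = ncups i p ++ [:: (Cup, i + p)] :> word V.
Proof. by rewrite /ncups -[in LHS]addn1 iotaD map_cat. Qed.

Lemma shift_ncaps d i p : shift d (ncaps i p) = ncaps (d + i) p :> word V.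
Proof. by rewrite /shift /ncaps -map_comp; apply: eq_map => j /=; rewrite addnA. Qed.

Lemma fits_ncaps m i p : i <= m -> fits (m + p.*2) (ncaps i p : word V) m.
Proof.
move=> im; elim: p => [|p IHp]; first by rewrite /= addn0.
rewrite ncapsS /= (_ : m + p.+1.*2 - 2 + 0 = m + p.*2) ?IHp; lia.
Qed.

Lemma fits_ncups m i p : i <= m -> fits m (ncups i p : word V) (m + p.*2).
Proof.
move=> im; elim: p => [|p IHp]; first by rewrite /= addn0.
rewrite ncupsS; apply: fits_trans IHp _ => /=.
by rewrite addn0 subn0 doubleS; lia.
Qed.

Definition caps (ps : seq nat) : word V := [seq (Cap, i) | i <- ps].

Lemma caps_cat ps qs : caps (ps ++ qs) = caps ps ++ caps qs.
Proof. exact: map_cat. Qed.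

Lemma shift_caps i ps : shift i (caps ps) = caps [seq (i + p)%N | p <- ps].
Proof. by rewrite /shift /caps -!map_comp. Qed.

End Heights.

(* The positions in the mirror image of a word of caps on [m] strings. *)
Fixpoint flip (m : nat) (ps : seq nat) : seq nat :=
  if ps is p :: ps' then (m - 2 - p)%N :: flip (m - 2) ps' else [::].

Section Flip.
Variable V : bool -> nat -> Type.
Local Open Scope nat_scope.

(** The [d] strings to the right of the caps are on their left after reflection, whence the
    shift. *)
Lemma mirror_flip (star : forall s n, V s n -> V s n) m n d ps :
  fits m (caps V ps) n ->
  mirror star (m + d) (caps V ps) = shift d (caps V (flip m ps)).
Proof.
elim: ps m => //= p ps IHps m /andP[pm].
rewrite addn0 => fps; congr (_ :: _); first by congr (_, _); lia.
by rewrite addn0 -(IHps _ fps); congr mirror; lia.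
Qed.

Lemma fits_flip m n ps : fits m (caps V ps) n -> fits m (caps V (flip m ps)) n.
Proof.
elim: ps m => //= p ps IHps m /andP[pm]; rewrite addn0 => /IHps ->.
by rewrite andbT; lia.
Qed.

Lemma flip_rcons m n ps p : fits m (caps V ps) n ->
  flip m (rcons ps p) = rcons (flip m ps) (n - 2 - p).
Proof.
elim: ps m => [|q ps IHps] m /=; first by move/eqP->.
by case/andP=> _; rewrite addn0 => /IHps ->.
Qed.

Lemma flipS m n ps : fits m (caps V ps) n -> flip m.+1 ps = map succn (flip m ps).
Proof.
elim: ps m => [|q ps IHps] m //= /andP[qm]; rewrite addn0 => fps.
by rewrite -(IHps _ fps); congr (_ :: _); [|congr flip]; lia.
Qed.

Lemma odd_fits m n ps : fits m (caps V ps) n -> odd m = odd n.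
Proof.
elim: ps m => [|q ps IHps] m /=; first by move/eqP->.
case/andP=> qm; rewrite addn0 => /IHps <-; rewrite oddB ?addbF //.
by apply: leq_trans qm; exact: leq_addl.
Qed.
End Flip.

(** * Isotopy *)

Section Isotopy.
Variables (C : numClosedFieldType) (P : planar_algebra C).
Local Notation word := (word (box P)).
Local Open Scope nat_scope.

Definition weq (m : nat) (w w' : word) : Prop :=
  forall s n w1 w2, height 0 w1 = m ->
    Z s n (w1 ++ w ++ w2) = Z s n (w1 ++ w' ++ w2).

Lemma weq_refl m w : weq m w w. Proof. by []. Qed.
Lemma weq_sym m w w' : weq m w w' -> weq m w' w.
Proof. by move=> h s n w1 w2 /h ->. Qed.
Lemma weq_trans m w' w w'' : weq m w w' -> weq m w' w'' -> weq m w w''.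
Proof. by move=> h h' s n w1 w2 hw; rewrite h // h'. Qed.

Lemma weq_cat m w w' u u' :
  weq m w w' -> weq (height m w') u u' -> weq m (w ++ u) (w' ++ u').
Proof.
move=> ww' uu' s n w1 w2 hw; rewrite -!catA ww' // !(catA w1) uu' //.
by rewrite height_cat hw.
Qed.

Lemma weq_catr m w w' u : weq m w w' -> weq m (w ++ u) (w' ++ u).
Proof. by move=> h; apply: weq_cat. Qed.

Lemma weq_catl m w u u' : weq (height m w) u u' -> weq m (w ++ u) (w ++ u').
Proof. by move=> h; apply: weq_cat. Qed.

(** The hypotheses make the two words legal in the same contexts; elsewhere both values are 0. *)
Lemma weq_isotopy m v v' : isotopy v v' ->
  (forall s, all (fun ei => shading_ok s ei.1 ei.2) v =
             all (fun ei => shading_ok s ei.1 ei.2) v') ->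
  height m v = height m v' ->
  fits m v (height m v) = fits m v' (height m v') ->
  weq m v v'.
Proof.
move=> vv' sh_vv' h_vv' fit_vv' s n w1 w2 hw1.
have tE : tangle s n (w1 ++ v ++ w2) = tangle s n (w1 ++ v' ++ w2).
  rewrite /tangle !stack_cat hw1; congr (_ && _).
  by rewrite -h_vv' !stackE sh_vv' fit_vv' h_vv'.
have [t | nt] := boolP (tangle s n (w1 ++ v ++ w2)).
  by apply: Z_isotopy => //; rewrite -tE.
by rewrite !Z_default // -tE.
Qed.

Lemma weq_exchange m (e f : level (box P)) i k :
  weq m [:: (e, i); (f, i + outs e + k)] [:: (f, i + ins e + k); (e, i)].
Proof.
(* With too few strings below, both orders of the two levels are illegal. *)
have [le|gt] := leqP (i + ins e + k + ins f) m; last first.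
  move=> s n w1 w2 hw1; rewrite !Z_default // /tangle stack_cat hw1.
    by rewrite !stackE /= !(leqNgt (i + ins e + k + ins f)) gt /= !andbF.
  rewrite !stackE /=; apply/negP => /andP[_] /andP[/andP[? /andP[? _]] _]; lia.
apply: weq_isotopy => [|s||] /=; first exact: Iso_exchange.
- rewrite !andbT andbC; congr (_ && _).
  by apply: shading_ok_odd; rewrite !oddD odd_ins odd_outs.
- lia.
- by rewrite !eqxx !andbT; lia.
Qed.

(** Here a bound on [m] is required: the empty word fits on any number of strings, the zigzag does
    not. *)
Lemma weq_zigzag m i : i.+1 <= m -> weq m [:: (Cup, i.+1); (Cap, i)] [::].
Proof.
move=> im; apply: weq_isotopy => //=; first exact: Iso_zigzag_left.
  by lia.
by rewrite !eqxx; lia.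
Qed.

Lemma weq_interchange1 h m (e : level (box P)) i w : i + ins e <= m ->
  weq h ((e, i) :: shift (m - ins e + outs e) w) (shift m w ++ [:: (e, i)]).
Proof.
move=> im; elim: w h => [|[f j] w IHw] h /=; first exact: weq_refl.
pose k := m - ins e - i + j.
apply: (weq_trans (w' := (f, m + j) :: (e, i) :: shift (m - ins e + outs e) w)).
  apply: (@weq_catr _ [:: _; _] [:: _; _]).
  have -> : m - ins e + outs e + j = i + outs e + k by rewrite /k; lia.
  have -> : m + j = i + ins e + k by rewrite /k; lia.
  exact: weq_exchange.
exact: (@weq_catl _ [:: _]).
Qed.

(** The interchange law: [u] lies on the left and [w] on the right, so either may be drawn first. *)
Lemma weq_interchange h m n u w : fits m u n ->
  weq h (u ++ shift n w) (shift m w ++ u).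
Proof.
elim: u m h => [|[e i] u IHu] m h /=.
  by move/eqP->; rewrite cats0; exact: weq_refl.
case/andP=> im fu; apply: weq_trans.
  exact: (@weq_catl _ [:: _]) (IHu _ _ fu).
by rewrite -[in X in weq _ _ X]cat1s !catA; apply: weq_catr; exact: weq_interchange1.
Qed.

(* A cap slides along nested arcs to become a cup at their other end. *)
Lemma weq_cap_ncaps m B c q : q <= c -> B + c.*2.+2 <= m ->
  weq m ((Cap, B + q) :: ncaps B c)
        ((Cup, B + c.*2.+2 - q) :: ncaps B c.+2).
Proof.
move=> qc; have [d cE] : exists d, c = q + d by exists (c - q); lia.
elim: d m c {qc} cE => [|d IHd] m c cE hm.
  (* At the innermost place the cap is one more nested arc, and the new cup is straightened against
     the innermost arc of the other side. *)
  move: cE; rewrite addn0 => <-{q}.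
  rewrite -ncapsS !(ncapsS _ _ c.+1).
  have -> : B + c.*2.+2 - c = (B + c.+1).+1 by lia.
  apply: weq_sym; rewrite -[X in weq _ _ X]cat0s.
  by apply: (@weq_catr _ [:: _; _] [::]); apply: weq_zigzag; lia.
case: c cE hm => [|c] cE hm; first by lia.
rewrite ncapsS; apply: weq_trans.
  apply: (@weq_catr _ [:: _; _] _ (ncaps B c)).
  have -> : B + c = B + q + outs (Cap : level (box P)) + (c - q) by rewrite /=; lia.
  exact: weq_exchange.
apply: weq_trans.
  apply: (@weq_catl _ [:: _]); apply: IHd => /=; lia.
rewrite (ncapsS _ _ c.+2).
apply: (@weq_catr _ [:: _; _] [:: _; _]).
have := @weq_exchange m Cap Cup (B + q + 2 + (c - q)) (c - q).
rewrite /=.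
have -> : B + q + 2 + (c - q) + 0 + (c - q) = B + c.*2.+2 - q by lia.
have -> : B + q + 2 + (c - q) + 2 + (c - q) = B + c.+1.*2.+2 - q by lia.
by have -> : B + q + 2 + (c - q) = B + c.+2 by lia.
Qed.

(** The same move along nested minima: a cup at their right end becomes a cap at their left end. *)
Lemma weq_ncups_cap c q : q <= c ->
  weq 0 (ncups 0 c ++ [:: (Cup, c.*2 - q)]) (ncups 0 c.+2 ++ [:: (Cap, q)]).
Proof.
move=> qc; have [d cE] : exists d, c = q + d by exists (c - q); lia.
elim: d c {qc} cE => [|d IHd] c cE.
  move: cE; rewrite addn0 => <-{q}.
  have -> : c.*2 - c = 0 + c by lia.
  rewrite -ncupsS !(ncupsS _ _ c.+1) -catA -[X in weq _ X _]cats0.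
  apply: weq_catl; apply: weq_sym; apply: weq_zigzag.
  by rewrite (fits_height (fits_ncups _ _ (leqnn 0))); lia.
case: c cE => [|c] cE; first by lia.
rewrite ncupsS -catA; apply: weq_trans.
  apply: weq_catl.
  have -> : c.+1.*2 - q = c + outs (Cup : level (box P)) + (c - q) by rewrite /=; lia.
  exact: weq_exchange.
rewrite -cat1s catA; apply: weq_trans.
  apply: weq_catr.
  have -> : 0 + c + ins (Cup : level (box P)) + (c - q) = c.*2 - q by rewrite /=; lia.
  by apply: IHd; lia.
rewrite (ncupsS _ _ c.+2) -!catA; apply: weq_catl.
have := @weq_exchange (height 0 (ncups 0 c.+2 : word)) Cap Cup q (c - q).
rewrite /=.
have -> : q + 0 + (c - q) = 0 + c by lia.
by have -> : q + 2 + (c - q) = 0 + c.+2 by lia.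
Qed.

(* The caps act on the last strings of [v], which are carried once around [v]
   by nested arcs; they slide along the arcs to the left side of [v]. *)
Lemma weq_caps_turn a c d v ps : fits 0 v (d + a) -> fits a (caps (box P) ps) c ->
  weq 0 (ncups 0 c ++ shift c (v ++ shift d (caps (box P) ps)) ++ ncaps (c + d) c)
        (ncups 0 a ++ shift a v ++ ncaps (a + d) a ++ caps (box P) ps).
Proof.
elim: ps a v => [|q ps IHps] a v fv.
  by move/eqP=> ->; rewrite !cats0; exact: weq_refl.
have capsE : caps (box P) (q :: ps) = [:: (Cap, q)] ++ caps (box P) ps by [].
move=> fqps; have : (q + 2 <= a) && fits (a - 2 + 0) (caps (box P) ps) c by [].
rewrite addn0 {fqps}; case: a fv => [|[|a]] fv; rewrite ?addn2 //.
rewrite subn2 !ltnS => /andP[qa fps].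
have fv' : fits 0 (v ++ [:: (Cap, d + q)]) (d + a).
  by apply: fits_trans fv _; rewrite /=; lia.
(* The first cap is absorbed into [v], so that the induction hypothesis turns the remaining ones;
   only this cap is left to be moved. *)
rewrite (_ : v ++ shift d _ =
    (v ++ [:: (Cap, d + q)]) ++ shift d (caps _ ps)); last first.
  by rewrite -catA.
apply: weq_trans (IHps a _ fv' fps) _.
rewrite capsE !catA; apply: weq_catr.
rewrite !shift_cat -!catA.
have hs : fits a.*2 (shift a v : word) (a + (d + a.+2) + a).
  have := fits_shift (leqnn a) fv; rewrite addn0.
  move=> /(fits_shift (i := 0) (d := a) (leq0n _)).
  by rewrite shift0 addnn => h; rewrite addnC.
have hc := fits_ncups (box P) a (leqnn 0); rewrite add0n in hc.
apply: weq_trans.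
  apply: weq_catl; apply: weq_catl.
  rewrite (_ : shift a [:: _] = [:: (Cap, a + d + q)]); last by rewrite /= addnA.
  apply: weq_cap_ncaps; first by [].
  by rewrite (fits_height hc) (fits_height hs); lia.
(* The cap has become a cup on the right of [v]; it is moved below [v]. *)
apply: (weq_trans (w' :=
  (ncups 0 a ++ [:: (Cup, a.*2 - q)]) ++ shift a v ++ ncaps (a + d) a.+2)).
  rewrite -catA; apply: weq_catl.
  rewrite -cat1s catA (catA [:: _]); apply: weq_catr.
  have fs := fits_shift (leqnn a) fv; rewrite addn0 in fs.
  have := @weq_interchange (height 0 (ncups 0 a : word)) _ _ _ [:: (Cup, a - q)] fs.
  rewrite /shift /= -/(shift a v).
  have -> : a + (d + a.+2) + (a - q) = a + d + a.*2.+2 - q by lia.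
  by have -> : a + (a - q) = a.*2 - q by lia.
(* Sliding along the lower arcs makes it a cap again, now on the left of [v]; it then rises past [v]
   and the upper arcs. *)
apply: weq_trans; first by apply: weq_catr; apply: weq_ncups_cap.
rewrite -catA; apply: weq_catl.
have := @weq_interchange (height 0 (ncups 0 a.+2 : word))
  a.+2 a [:: (Cap, q)] (v ++ ncaps d a.+2).
rewrite !shift_cat !shift_ncaps /= -!catA; apply.
by rewrite addn0; lia.
Qed.

End Isotopy.
(** * Ballot sequences and planar pairings *)

Section Ballots.
Local Open Scope nat_scope.

(* In these words [true] is a down step: the right end of an arc. *)
Definition level_after (h : nat) (b : seq bool) : nat :=
  foldl (fun h c => if c then h.-1 else h.+1) h b.

(** The [h] strings not yet closed occupy the positions below [h] and the next point is at position
    [h]; a right end is joined to the last of them, by a cap at [h.-1]. *)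
Fixpoint cap_word (h : nat) (b : seq bool) : seq nat :=
  if b is c :: b' then
    if c then h.-1 :: cap_word h.-1 b' else cap_word h.+1 b'
  else [::].

(** Listed by their last step, because the gluing argument moves the last point. *)
Fixpoint ballots (n : nat) : seq (seq bool) :=
  if n is n'.+1 then
    flatten [seq rcons b false ::
                 (if level_after 0 b == 0 then [::] else [:: rcons b true])
            | b <- ballots n']
  else [:: [::]].

Definition ballot (b : seq bool) : bool :=
  all (fun i => nth false b i ==> (0 < level_after 0 (take i b))) (iota 0 (size b)).

Lemma level_after_rcons h b c :
  level_after h (rcons b c) =
  if c then (level_after h b).-1 else (level_after h b).+1.
Proof. exact: foldl_rcons. Qed.

Lemma cap_word_rcons h b c :
  cap_word h (rcons b c) =
  if c then rcons (cap_word h b) (level_after h b).-1 else cap_word h b.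
Proof. by elim: b h => [|[] b IHb] h //=; rewrite IHb; case: c {IHb}. Qed.

Lemma ballot_rcons b c :
  ballot (rcons b c) = ballot b && (c ==> (0 < level_after 0 b)).
Proof.
rewrite /ballot size_rcons -[(size b).+1]addn1 iotaD all_cat /= andbT add0n.
rewrite nth_rcons ltnn eqxx -cats1 take_size_cat //; congr (_ && _).
apply: eq_in_all => i; rewrite mem_iota /= add0n => ib.
by rewrite nth_cat ib takel_cat // ltnW.
Qed.

Lemma mem_ballots n b : (b \in ballots n) = (size b == n) && ballot b.
Proof.
elim: n b => [|n IHn] b; first by case: b => //=; rewrite inE.
apply/flatten_mapP/idP => [[b' b'n]|].
  move: b'n; rewrite IHn => /andP[/eqP sb' bb'].
  rewrite inE => /predU1P[->|].
    by rewrite size_rcons sb' eqxx ballot_rcons bb'.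
  case: eqP => // /eqP hb'; rewrite inE => /eqP->.
  by rewrite size_rcons sb' eqxx ballot_rcons bb' lt0n.
case: (lastP b) => // {b} b c; rewrite size_rcons eqSS ballot_rcons.
case/and3P => sb bb cb; exists b; first by rewrite IHn sb.
case: c cb => /=; last by rewrite inE eqxx.
by rewrite lt0n inE => /negPf->; rewrite inE eqxx orbT.
Qed.

Lemma uniq_ballots n : uniq (ballots n).
Proof.
elim: n => //= n; elim: (ballots n) => //= b s IHs /andP[bs us].
have notin c : rcons b c \notin
    flatten [seq rcons b' false ::
      (if level_after 0 b' == 0 then [::] else [:: rcons b' true]) | b' <- s].
  apply: contra bs => /flatten_mapP[b' b's]; rewrite inE => /predU1P[|].
    by move/rcons_inj => -[->].
  by case: ifP => // _; rewrite inE => /eqP/rcons_inj[->].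
rewrite mem_cat negb_or notin cat_uniq has_sym IHs // !andbT.
case: ifP => _ /=; rewrite ?inE ?(negPf (notin _)) //= andbT.
by apply/negP => /eqP/rcons_inj[].
Qed.

Lemma big_ballotsS (W : nmodType) n (F : seq bool -> W) :
  (\sum_(b <- ballots n.+1) F b =
   \sum_(b <- ballots n) (F (rcons b false) +
     if level_after 0 b == 0%N then 0 else F (rcons b true)))%R.
Proof.
rewrite /= big_flatten big_map; apply: eq_bigr => b _.
by rewrite big_cons; case: ifP => _; rewrite ?big_nil ?big_seq1.
Qed.

(** This is the shape of [arc_positions], with one optional position for each point. *)
Lemma cap_wordE b :
  cap_word 0 b =
  pmap (fun i => if nth false b i then Some (level_after 0 (take i b)).-1 else None)
    (iota 0 (size b)).
Proof.
elim/last_ind: b => // b c IHb.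
rewrite cap_word_rcons size_rcons -[(size b).+1]addn1 iotaD pmap_cat /= add0n nth_rcons.
rewrite ltnn eqxx (_ : take (size b) (rcons b c) = b) ?IHb; last first.
  by rewrite -cats1 take_size_cat.
have -> : pmap (fun i => if nth false (rcons b c) i
      then Some (level_after 0 (take i (rcons b c))).-1 else None) (iota 0 (size b))
    = pmap (fun i => if nth false b i
      then Some (level_after 0 (take i b)).-1 else None) (iota 0 (size b)).
  apply: eq_in_pmap => i; rewrite mem_iota /= add0n => ib.
  by rewrite nth_rcons ib -cats1 takel_cat // ltnW.
by case: c => /=; rewrite ?cats1 ?cats0.
Qed.

End Ballots.

(** * Planar pairings of points on a line and their height functions *)

Section Matchings.
Local Open Scope nat_scope.

(* The points [l < r] are joined in the pairing with heights [h]: [h t] is the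
   number of arcs open just before the point [t]. *)
Definition matched (h : nat -> nat) (l r : nat) : bool :=
  [&& l < r, h r.+1 == h l & all (fun t => h l < h t) (iota l.+1 (r - l))].

Lemma matchedP h l r :
  reflect [/\ l < r, h r.+1 = h l & forall t, l < t -> t <= r -> h l < h t]
          (matched h l r).
Proof.
apply: (iffP and3P) => -[lr hlr H]; split => //.
- exact/eqP.
- by move=> t lt tr; apply: (allP H); rewrite mem_iota; lia.
- exact/eqP.
- by apply/allP => t; rewrite mem_iota => ?; apply: H; lia.
Qed.

Definition partners h x y := matched h x y || matched h y x.

Lemma partners_sym h x y : partners h x y = partners h y x.
Proof. exact: orbC. Qed.

(** The height stays strictly above its starting level along an arc and returns to it just after;
    two arcs sharing one end would contradict this. *)
Lemma partners_inj h x y z : partners h x y -> partners h x z -> y = z.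
Proof.
move=> /orP[] /matchedP[a1 a2 a3] /orP[] /matchedP[b1 b2 b3].
- by have [yz|zy|//] := ltngtP y z; [have := b3 y.+1 | have := a3 z.+1]; lia.
- by have := b3 x b1 (leqnn x); have := b3 y.+1; have := a3 x.+1; lia.
- by have := a3 x a1 (leqnn x); have := a3 z.+1; have := b3 x.+1; lia.
- by have [yz|zy|//] := ltngtP y z; [have := a3 z | have := b3 y]; lia.
Qed.

Lemma matched_noncrossing h x x' y y' :
  matched h x x' -> matched h y y' -> ~~ [&& x < y, y < x' & x' < y'].
Proof.
move=> /matchedP[a1 a2 a3] /matchedP[b1 b2 b3]; apply/negP => /and3P[xy yx xy'].
by have := a3 y; have := b3 x'.+1; lia.
Qed.

Section ExistsPartner.
Variables (h : nat -> nat) (K : nat).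
Hypotheses (h0 : h 0 = 0) (hK : h K = 0).
Hypothesis h_step : forall t, t < K -> h t.+1 = (h t).+1 \/ h t = (h t.+1).+1.

Lemma matched_left r : r < K -> h r = (h r.+1).+1 -> exists l, matched h l r.
Proof using h0 h_step.
clear hK.
move=> rK hr.
have ex : exists l, (l < r) && (h l < h r).
  by exists 0; rewrite h0 hr andbT lt0n; apply/eqP => r0; move: hr; rewrite r0 h0.
have ub l : (l < r) && (h l < h r) -> l <= r by case/andP=> /ltnW.
(* The left end is the last earlier point of height below that of [r]. *)
case: (ex_maxnP ex ub) => l /andP[lr hl] l_max; exists l; apply/matchedP.
have above t : l < t -> t <= r -> h r <= h t.
  move=> lt tr; rewrite leqNgt; apply/negP => ht.
  have tr' : t < r.
    rewrite ltn_neqAle tr andbT; apply/eqP => tE; move: ht; rewrite tE; lia.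
  by have := l_max t; rewrite tr' ht => /(_ isT); lia.
split=> //; last by move=> t lt tr; apply: leq_trans hl _; exact: above.
by have := above l.+1; have := @h_step l; lia.
Qed.

Lemma matched_right l : l < K -> h l.+1 = (h l).+1 -> exists2 r, r < K & matched h l r.
Proof using hK h_step.
clear h0.
move=> lK hl.
have ex : exists r, [&& l < r, r < K & h r.+1 <= h l].
  exists K.-1; have -> : K.-1.+1 = K by lia.
  rewrite hK leq0n andbT; apply/andP; split; last by lia.
  have : l != K.-1 by apply/eqP => lE; move: hl; rewrite lE (_ : K.-1.+1 = K) ?hK; lia.
  by lia.
(* The right end is the first later point after which the height is back at or below that of [l]. *)
case: (ex_minnP ex) => r /and3P[lr rK hr] r_min; exists r => //; apply/matchedP.
have above t : l < t -> t <= r -> h l < h t.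
  move=> lt tr; rewrite ltnNge; apply/negP => ht.
  have tl : t != l.+1 by apply/eqP => tE; move: ht; rewrite tE; lia.
  have := r_min t.-1; have -> : t.-1.+1 = t by lia.
  by rewrite ht andbT; lia.
split=> //; first by have := above r; have := h_step rK; lia.
Qed.

End ExistsPartner.

Section Planar.
Variables (K : nat) (F : 'I_K -> 'I_K).
Hypotheses (FK : involutive F) (Fne : forall x, F x != x).
Hypothesis F_planar : forall x y : 'I_K, ~~ [&& x < y, y < F x & F x < F y].

Definition open_arcs (t : nat) : nat := \sum_(p < K) ((p < t) && (t <= F p)).

Definition closings : seq bool := [seq F i < i | i <- enum 'I_K].

Lemma nth_closings (i : 'I_K) : nth false closings i = (F i < i).
Proof. by rewrite (nth_map i) ?size_enum_ord // nth_ord_enum. Qed.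

Lemma size_closings : size closings = K.
Proof. by rewrite size_map size_enum_ord. Qed.

Lemma open_arcs0 : open_arcs 0 = 0. Proof. by rewrite /open_arcs big1. Qed.

Lemma open_arcs_end : open_arcs K = 0.
Proof. by rewrite /open_arcs big1 // => p _; rewrite [K <= _]leqNgt !ltn_ord. Qed.

(** The two counts differ only at [p = t], which may open an arc, and at [p = F t], whose arc may be
    closed at [t]. *)
Lemma open_arcsS (t : 'I_K) :
  open_arcs t.+1 + (F t < t) = open_arcs t + (t < F t).
Proof.
have -> : (F t < t) = (\sum_(p < K) ((p < t) && (F p == t))) :> nat.
  rewrite (bigD1 (F t)) //= FK eqxx andbT big1 ?addn0 // => p.
  by rewrite -[p in p != _]FK (inj_eq (can_inj FK)) andbC => /negPf->.
have -> : (t < F t) = (\sum_(p < K) ((p == t) && (t < F p))) :> nat.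
  by rewrite (bigD1 t) //= eqxx /= big1 ?addn0 // => p /negPf->.
rewrite /open_arcs -!big_split; apply: eq_bigr => p _ /=.
by rewrite -!val_eqE /=; have := Fne p; rewrite -val_eqE /=; lia.
Qed.

Lemma F_neq (t : 'I_K) : F t <> t :> nat.
Proof. by move/val_inj/eqP; apply/negP. Qed.

Lemma open_arcs_step (t : 'I_K) :
  open_arcs t.+1 = if F t < t then (open_arcs t).-1 else (open_arcs t).+1.
Proof. by have := open_arcsS t; have := @F_neq t; case: ifP; lia. Qed.

Lemma open_arcs_gt0 (t : 'I_K) : F t < t -> 0 < open_arcs t.
Proof. by have := open_arcsS t; lia. Qed.

Lemma level_closings t : t <= K -> level_after 0 (take t closings) = open_arcs t.
Proof.
elim: t => [|t IHt] tK; first by rewrite take0 open_arcs0.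
have tK' : t < size closings by rewrite size_closings.
rewrite (take_nth false tK') level_after_rcons (IHt (ltnW tK)).
have -> : nth false closings t = (F (Ordinal tK) < t) := nth_closings (Ordinal tK).
exact: esym (open_arcs_step (Ordinal tK)).
Qed.

Lemma ballot_closings : ballot closings.
Proof.
apply/allP => i; rewrite mem_iota size_closings /= add0n => iK; apply/implyP.
have -> : nth false closings i = (F (Ordinal iK) < i) := nth_closings (Ordinal iK).
rewrite (level_closings (ltnW iK)); exact: (@open_arcs_gt0 (Ordinal iK)).
Qed.

(** By planarity the arcs open just before [l] are those enclosing the arc at [l]. The same sum
    counts the arcs open after [F l], so the two heights agree. *)
Lemma open_arcs_left (l : 'I_K) : l < F l ->
  open_arcs l = \sum_(p < K) ((p < l) && (F l < F p)).
Proof.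
move=> lr; apply: eq_bigr => p _; congr (nat_of_bool _).
case: (ltnP p l) => //= pl.
have nFl : F p != l.
  by rewrite -[X in _ != X]FK (inj_eq (can_inj FK)); apply: contraTneq lr => <-; lia.
have nFr : F p != F l by rewrite (inj_eq (can_inj FK)); apply: contraTneq pl => ->; lia.
by have := F_planar p l; move: nFl nFr; rewrite -!val_eqE /= pl; lia.
Qed.

Lemma open_arcs_right (l : 'I_K) : l < F l ->
  open_arcs (F l).+1 = \sum_(p < K) ((p < l) && (F l < F p)).
Proof.
move=> lr; apply: eq_bigr => p _; congr (nat_of_bool _).
have [pl|lp|/val_inj->] := ltngtP p l; last by rewrite !ltnn andbF.
  by lia.
have [pr|rp|/val_inj->] := ltngtP p (F l); last by rewrite FK; lia.
  by have := F_planar l p; lia.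
by lia.
Qed.

Lemma matched_open_arcs (l : 'I_K) : l < F l -> matched open_arcs l (F l).
Proof.
move=> lr; apply/matchedP; split=> //; first by rewrite open_arcs_right ?open_arcs_left.
(* Under the arc all the enclosing arcs are still open, and the arc at [l] itself is one more. *)
move=> t lt tr; rewrite open_arcs_left // /open_arcs (bigD1 l) //= ltnn /= add0n.
rewrite [X in _ < X](bigD1 l) //= lt tr add1n ltnS; apply: leq_sum => p _.
by lia.
Qed.

Lemma partners_open_arcs (x : 'I_K) : partners open_arcs x (F x).
Proof.
have [xF|Fx|/esym/F_neq//] := ltngtP x (F x); apply/orP; [left|right].
  exact: matched_open_arcs.
by rewrite -{2}[x]FK; apply: matched_open_arcs; rewrite FK.
Qed.

End Planar.

(** The closings determine the heights, and the heights determine the partner of each point. *)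
Lemma closings_inj K (F G : 'I_K -> 'I_K) :
  involutive F -> (forall x, F x != x) ->
  (forall x y : 'I_K, ~~ [&& x < y, y < F x & F x < F y]) ->
  involutive G -> (forall x, G x != x) ->
  (forall x y : 'I_K, ~~ [&& x < y, y < G x & G x < G y]) ->
  closings F = closings G -> F =1 G.
Proof.
move=> FK Fne Fp GK Gne Gp FG x; apply: val_inj.
apply: (@partners_inj (open_arcs F) x); first exact: partners_open_arcs.
have := partners_open_arcs GK Gne Gp x.
have hE t : t <= K -> open_arcs G t = open_arcs F t.
  by move=> tK; rewrite -!level_closings // FG.
have xK := ltn_ord x; have yK := ltn_ord (G x).
rewrite /partners => /orP[] /matchedP[a1 a2 a3]; apply/orP; [left|right];
  apply/matchedP; split=> // [|t lt tr].
- by rewrite -(hE _ yK) -(hE _ (ltnW xK)).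
- have tK : t <= K by exact: leq_trans tr (ltnW yK).
  by rewrite -(hE _ tK) -(hE _ (ltnW xK)); exact: a3.
- by rewrite -(hE _ xK) -(hE _ (ltnW yK)).
- have tK : t <= K by exact: leq_trans tr (ltnW xK).
  by rewrite -(hE _ tK) -(hE _ (ltnW yK)); exact: a3.
Qed.

End Matchings.

(** * Epi diagrams correspond to ballot sequences *)

Section EpiBallots.
Variables m n : nat.
Local Open Scope nat_scope.

(** [boundary_pos] as a bijection, which turns a pairing of the rectangle into an involution of
    points on a line. *)
Definition boundary (x : 'I_m + 'I_n) : 'I_(m + n) :=
  unsplit (match x with inl b => inl b | inr t => inr (rev_ord t) end).

Definition unboundary (i : 'I_(m + n)) : 'I_m + 'I_n :=
  match split i with inl b => inl b | inr t => inr (rev_ord t) end.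

Lemma boundaryK : cancel boundary unboundary.
Proof. by case=> x; rewrite /unboundary /boundary unsplitK ?rev_ordK. Qed.

Lemma unboundaryK : cancel unboundary boundary.
Proof.
move=> i; rewrite /unboundary /boundary -[RHS]splitK.
by case: (split i) => // t; rewrite rev_ordK.
Qed.

Lemma val_boundary x : boundary x = boundary_pos x :> nat.
Proof. by case: x. Qed.

Lemma unboundary_top (i : 'I_(m + n)) : m <= i -> exists t, unboundary i = inr t.
Proof.
rewrite /unboundary => mi; case: splitP => [b ib | t _]; last by exists (rev_ord t).
by have := ltn_ord b; lia.
Qed.

Definition around (f : {ffun 'I_m + 'I_n -> 'I_m + 'I_n}) (i : 'I_(m + n)) :=
  boundary (f (unboundary i)).

Lemma planar_pairingP f :
  reflect [/\ involutive (around f), forall x, around f x != x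
            & forall x y : 'I_(m + n),
                ~~ [&& x < y, y < around f x & around f x < around f y]]
          (planar_pairing f).
Proof.
apply: (iffP andP) => [[/forallP fK /forallP fp] | [fK fne fp]].
  split=> [x|x|x y].
  - have /andP[_ /eqP] := fK (unboundary x); rewrite /around boundaryK => ->.
    exact: unboundaryK.
  - have /andP[+ _] := fK (unboundary x); apply: contra => /eqP fx.
    by rewrite /around in fx; rewrite -{2}fx boundaryK.
  - have := forallP (fp (unboundary x)) (unboundary y).
    by rewrite -!val_boundary !unboundaryK.
split; apply/forallP => x.
  have := fne (boundary x); have := fK (boundary x); rewrite /around !boundaryK.
  move=> /(can_inj boundaryK) ->; rewrite eqxx andbT.
  by rewrite (inj_eq (can_inj boundaryK)).
apply/forallP => y; have := fp (boundary x) (boundary y).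
by rewrite /around !boundaryK !val_boundary.
Qed.

Lemma around_inj f g : around f =1 around g -> f = g.
Proof.
move=> fg; apply/ffunP => x; apply: (can_inj boundaryK).
by have := fg (boundary x); rewrite /around !boundaryK.
Qed.

Definition ballot_of (f : TL m n) : seq bool := take m (closings (around (val f))).

Lemma size_word_of f : size (ballot_of f) = m.
Proof. by rewrite size_takel // size_closings leq_addr. Qed.

Lemma epi_top (f : TL m n) (i : 'I_(m + n)) : epi f -> m <= i -> around (val f) i < m.
Proof.
move=> /forallP fe /unboundary_top[t it]; have /existsP[b /eqP fb] := fe t.
by rewrite /around it fb val_boundary; exact: ltn_ord.
Qed.

(** Along the boundary the top points come last; being joined to bottom points, they are all right
    ends. *)
Lemma closings_epi (f : TL m n) : epi f ->
  closings (around (val f)) = ballot_of f ++ nseq n true.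
Proof.
move=> fe; apply: (@eq_from_nth _ false).
  by rewrite size_cat size_word_of size_nseq size_closings.
move=> i; rewrite size_closings => iK; rewrite nth_cat size_word_of.
case: ltnP => mi; first by rewrite nth_take.
have -> : nth false (closings (around (val f))) i = (around (val f) (Ordinal iK) < i).
  exact: (nth_closings _ (Ordinal iK)).
rewrite nth_nseq ltn_subLR // iK.
exact: leq_trans (epi_top (i := Ordinal iK) fe mi) mi.
Qed.

Lemma ballot_of_epi (f : TL m n) : epi f ->
  ballot_of f \in ballots m /\ level_after 0 (ballot_of f) = n.
Proof.
move=> fe; have [fK fne fp] := planar_pairingP _ (valP f); split.
  rewrite mem_ballots size_word_of eqxx /=.
  have /allP b := ballot_closings fK fne.
  apply/allP => i; rewrite mem_iota size_word_of /= add0n => im.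
  have := b i; rewrite mem_iota size_closings /= add0n ltn_addr // => /(_ isT).
  by rewrite /ballot_of nth_take // take_takel // ltnW.
rewrite /ballot_of level_closings // ?leq_addr //.
(* Each top point closes one arc, and no arc is open after the last of them. *)
suff H s : s <= n ->
    open_arcs (around (val f)) m = open_arcs (around (val f)) (m + s) + s.
  by rewrite (H n) // open_arcs_end.
elim: s => [|s IHs] sn; first by rewrite !addn0.
have iK : m + s < m + n by rewrite ltn_add2l.
have top := @epi_top f (Ordinal iK) fe (leq_addr _ _).
have := open_arcsS fK fne (Ordinal iK).
have lt_top : around (val f) (Ordinal iK) < m + s by apply: ltn_addr.
rewrite /= lt_top ltnNge (ltnW lt_top) addn0 addn1 IHs ?(ltnW sn) // => <-.
by rewrite !addnS addSn.
Qed.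

Lemma ballot_of_inj : {in @epi m n &, injective ballot_of}.
Proof.
move=> f g fe ge fg; apply: val_inj; apply: around_inj.
have [fK fne fp] := planar_pairingP _ (valP f).
have [gK gne gp] := planar_pairingP _ (valP g).
by apply: closings_inj => //; rewrite !closings_epi // fg.
Qed.

Lemma ballot_step b i : ballot b -> i < size b ->
  level_after 0 (take i.+1 b) = (level_after 0 (take i b)).+1 /\ ~~ nth false b i \/
  level_after 0 (take i b) = (level_after 0 (take i.+1 b)).+1 /\ nth false b i.
Proof.
move=> /allP bb ib; rewrite (take_nth false) // level_after_rcons.
have := bb i; rewrite mem_iota /= add0n ib => /(_ isT).
by case: nth => /= h; [right; split=> //; lia | left].
Qed.

Lemma level_after_cat_nseq b k :
  level_after 0 (b ++ nseq k true) = level_after 0 b - k.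
Proof.
elim: k => [|k IHk]; first by rewrite cats0 subn0.
by rewrite -[in nseq _ _]addn1 nseqD catA cats1 level_after_rcons IHk; lia.
Qed.

Lemma ballot_cat_nseq b k : ballot b -> k <= level_after 0 b -> ballot (b ++ nseq k true).
Proof.
move=> bb; elim: k => [|k IHk] kb; first by rewrite cats0.
rewrite -addn1 nseqD catA cats1 ballot_rcons IHk ?(ltnW kb) //=.
by rewrite level_after_cat_nseq; lia.
Qed.

(** Adding [n] down steps gives a path [c] from 0 to 0; the diagram joins the points matched by its
    heights. *)
Lemma ballot_of_onto b : b \in ballots m -> level_after 0 b = n ->
  exists2 f : TL m n, epi f & ballot_of f = b.
Proof.
rewrite mem_ballots => /andP[/eqP sb bb] hb.
pose c := b ++ nseq n true; pose h t := level_after 0 (take t c).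
have sc : size c = m + n by rewrite size_cat sb size_nseq.
have bc : ballot c by apply: ballot_cat_nseq => //; rewrite hb.
have h0 : h 0 = 0 by rewrite /h take0.
have hK : h (m + n) = 0.
  by rewrite /h -sc take_size /c level_after_cat_nseq hb subnn.
have step t : t < m + n ->
    h t.+1 = (h t).+1 /\ ~~ nth false c t \/ h t = (h t.+1).+1 /\ nth false c t.
  by rewrite -sc; exact: ballot_step.
have step' t : t < m + n -> h t.+1 = (h t).+1 \/ h t = (h t.+1).+1.
  by move=> /step[[? _]|[? _]]; [left|right].
(* The partner lies on the side announced by the step at [x], which makes [c] the sequence of
   closings. *)
have ex (x : 'I_(m + n)) : exists y : 'I_(m + n),
    partners h x y && ((y < x) == nth false c x).
  have [[hx cx]|[hx cx]] := step _ (ltn_ord x).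
    have [r rK xr] := matched_right hK step' (ltn_ord x) hx.
    exists (Ordinal rK); rewrite /partners xr (negPf cx) /=.
    by case/matchedP: xr => xr _ _; lia.
  have [l lx] := matched_left h0 step' (ltn_ord x) hx.
  have lK : l < m + n by case/matchedP: lx => lx _ _; have := ltn_ord x; lia.
  exists (Ordinal lK); rewrite /partners lx orbT cx /=.
  by case/matchedP: lx => lx _ _; lia.
pose F (x : 'I_(m + n)) : 'I_(m + n) := xchoose (ex x).
have FP (x : 'I_(m + n)) : partners h x (F x) /\ (F x < x) = nth false c x.
  by have /andP[? /eqP ?] := xchooseP (ex x).
pose f := [ffun x => unboundary (F (boundary x))].
have fF : around f =1 F by move=> x; rewrite /around ffunE !unboundaryK.
have FK : involutive F.
  move=> x; apply: val_inj; apply: (@partners_inj h (F x)); first by case: (FP (F x)).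
  by rewrite partners_sym; case: (FP x).
have planar_f : planar_pairing f.
  apply/planar_pairingP; split=> [x|x|x y]; rewrite ?fF //.
    by rewrite -val_eqE /=; have [/orP[/matchedP[]|/matchedP[]]] := FP x; lia.
  have [/orP[] Fx _] := FP x; have [/orP[] Fy _] := FP y.
  - exact: matched_noncrossing Fx Fy.
  - by case/matchedP: Fy; lia.
  - by case/matchedP: Fx; lia.
  - by case/matchedP: Fx; lia.
pose g : TL m n := Sub f planar_f.
have gc : closings (around (val g)) = c.
  apply: (@eq_from_nth _ false); first by rewrite size_closings sc.
  move=> i; rewrite size_closings => iK; rewrite (nth_closings _ (Ordinal iK)).
  by rewrite fF; have [_ ->] := FP (Ordinal iK).
exists g; last by rewrite /ballot_of gc take_size_cat.
apply/forallP => t; apply/existsP.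
(* Every top point is the right end of its arc, so two of them cannot be joined. *)
have top_closes (i : 'I_(m + n)) : m <= i -> F i < i.
  move=> mi; have [_ ->] := FP i; rewrite /c nth_cat sb ltnNge mi /= nth_nseq.
  by have := ltn_ord i; case: ifP => //; lia.
case Egt : (f (inr t)) => [b'|t']; first by exists b'.
have := top_closes (boundary (inr t)) (leq_addr _ _).
have := top_closes (boundary (inr t')) (leq_addr _ _).
have <- : F (boundary (inr t)) = boundary (inr t').
  by rewrite -fF /around boundaryK Egt.
by rewrite FK; lia.
Qed.

(** When an arc is closed, the strings on its left are the arcs enclosing it, through strings
    included; their number is the height just after its right end. *)
Lemma arc_positions_bottom (f : TL m n) :
  arc_positions (bottom_arc f) = cap_word 0 (ballot_of f).
Proof.
have [fK fne fp] := planar_pairingP _ (valP f).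
rewrite cap_wordE size_word_of -(val_enum_ord m) /arc_positions.
transitivity (pmap (fun r : 'I_m => if nth false (ballot_of f) r
    then Some (level_after 0 (take r (ballot_of f))).-1 else None) (enum 'I_m));
  last first.
  by elim: (enum 'I_m) => //= r s ->.
apply: eq_pmap => r; set F := around (val f) in fK fne fp *.
pose r' : 'I_(m + n) := lshift n r; have rm := ltn_ord r.
have -> : nth false (ballot_of f) r = (F r' < r').
  by rewrite nth_take // (nth_closings _ r').
have -> : level_after 0 (take r (ballot_of f)) = open_arcs F r'.
  rewrite /ballot_of (take_takel _ (ltnW rm)); apply: level_closings => //.
  exact: ltnW (ltn_addr n rm).
have Fr' : F r' = boundary (val f (inl r)).
  by rewrite /F /around -[r']/(boundary (inl r)) boundaryK.
rewrite {1}/bottom_arc; case Efr : (val f (inl r)) Fr' => [l|t] Fr'; last first.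
  by rewrite Fr' val_boundary /= ltnNge (ltnW (ltn_addr _ rm)).
rewrite Fr' val_boundary /=; case: ltnP => //= lr; congr Some.
pose l' : 'I_(m + n) := lshift n l.
have Fl' : F l' = r' by rewrite -[l']/(boundary (inl l)) -Fr' fK.
have lr' : l' < F l' by rewrite Fl'.
have := open_arcs_step fK fne r'; rewrite Fr' val_boundary /= lr => <-.
have := open_arcs_right fK fp lr'; rewrite Fl' /= => ->.
rewrite big_split_ord /= [X in (_ + X)%N]big1 ?addn0; last first.
  by move=> i _; rewrite ltnNge ltnW ?ltn_addr.
rewrite -sum1_card big_mkcond /=; apply: eq_bigr => p _; rewrite inE.
have -> : F (lshift n p) = boundary (val f (inl p)).
  by rewrite /F /around -[lshift n p]/(boundary (inl p)) boundaryK.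
rewrite /bottom_arc; case: (val f (inl p)) => [q|t]; rewrite val_boundary /=.
  by case: (_ && _).
by rewrite [r < _]ltn_addr // andbT; case: (_ < _).
Qed.

Lemma arc_positions_top (f : TL m n) : epi f -> arc_positions (top_arc f) = [::].
Proof.
move=> /forallP fe; rewrite /arc_positions; elim: (enum 'I_n) => //= t s ->.
by have /existsP[b /eqP fb] := fe t; rewrite {1}/top_arc fb.
Qed.

Lemma TL_word_epi (V : bool -> nat -> Type) (f : TL m n) : epi f ->
  TL_word V f = caps V (cap_word 0 (ballot_of f)).
Proof.
by move=> fe; rewrite /TL_word arc_positions_top // arc_positions_bottom cats0.
Qed.

Lemma big_epi_ballots (W : nmodType) (G : seq bool -> W) :
  (\sum_(f : TL m n | epi f) G (ballot_of f) =
   \sum_(b <- ballots m | level_after 0 b == n) G b)%R.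
Proof.
rewrite -big_filter -(big_map ballot_of xpredT) -[RHS]big_filter.
apply: perm_big; apply: uniq_perm.
- rewrite map_inj_in_uniq ?filter_uniq ?index_enum_uniq //.
  by move=> f g; rewrite !mem_filter => /andP[fe _] /andP[ge _]; exact: ballot_of_inj.
- by rewrite filter_uniq ?uniq_ballots.
move=> b; rewrite mem_filter; apply/mapP/andP.
  move=> [f]; rewrite mem_filter => /andP[fe _] ->.
  by have [-> ->] := ballot_of_epi fe; rewrite eqxx.
move=> [/eqP hb bm]; have [f fe <-] := ballot_of_onto bm hb.
by exists f; rewrite // mem_filter mem_index_enum andbT.
Qed.

End EpiBallots.

(** This lets the sum over all pairings be treated as a sum over epi diagrams. *)
Lemma epi_top0 m (f : TL m 0) : epi f.
Proof. by apply/forallP => -[]. Qed.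

(** * Gluing two diagrams *)

Section Gluing.
Variables (C : numClosedFieldType) (P : planar_algebra C).
Local Open Scope nat_scope.

Lemma fits_cap_word n b : b \in ballots n ->
  fits n (caps (box P) (cap_word 0 b)) (level_after 0 b).
Proof.
elim: n b => [|n IHn] b; first by rewrite inE => /eqP->.
have up m p (w : word (box P)) : fits m w p -> fits m.+1 w p.+1.
  by move=> fw; have := @fits_shift _ 1 0 _ _ _ isT fw; rewrite shift0.
case/flatten_mapP => b' /IHn fb'; rewrite inE => /predU1P[->|].
  by rewrite cap_word_rcons level_after_rcons; exact: up.
case: eqP => // /eqP hb'; rewrite inE => /eqP->.
rewrite cap_word_rcons level_after_rcons -cats1 caps_cat.
by apply: fits_trans (up _ _ _ fb') _ => /=; lia.
Qed.

Lemma level_after_leq n b : b \in ballots n -> level_after 0 b <= n.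
Proof.
elim: n b => [|n IHn] b; first by rewrite inE => /eqP->.
case/flatten_mapP => b' /IHn fb'; rewrite inE => /predU1P[->|].
  by rewrite level_after_rcons.
by case: eqP => // _; rewrite inE => /eqP->; rewrite level_after_rcons; lia.
Qed.

(* The pairing of [a + b] points obtained by joining the through strings of [w]
   and [v], [v] being read from right to left. *)
Definition glue (a b : nat) (w v : seq bool) : seq nat :=
  [seq a + p | p <- flip b (cap_word 0 v)] ++
  cap_word 0 w ++ rev (iota 0 (level_after 0 w)).

(** [phi] stands for the scalar obtained by closing two boxes with a word of caps. *)
Variables (W : zmodType) (phi : seq nat -> W).
Hypothesis phi_weq : forall ps qs,
  (forall m, weq m (caps (box P) ps) (caps (box P) qs)) -> phi ps = phi qs.

Lemma glueS_left a b w v : v \in ballots b ->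
  glue a.+1 b (rcons w true) v =
  [seq a + p | p <- flip b.+1 (cap_word 0 v)] ++
  cap_word 0 w ++ (level_after 0 w).-1 :: rev (iota 0 (level_after 0 w).-1).
Proof.
move=> /fits_cap_word fv.
rewrite /glue cap_word_rcons level_after_rcons cat_rcons (flipS fv) -map_comp.
by congr (_ ++ _); apply: eq_map => p /=; rewrite addnS.
Qed.

(** The arc at the moved point is the innermost glued arc on one side and the last cap of [v] on the
    other; the two words differ by exchanging it with the caps of [w]. *)
Lemma phi_glue_close a b w v : w \in ballots a -> v \in ballots b ->
  0 < level_after 0 v -> level_after 0 w = (level_after 0 v).-1 ->
  phi (glue a.+1 b (rcons w false) v) = phi (glue a b.+1 w (rcons v true)).
Proof.
move=> wa vb v0 wv; have fv := fits_cap_word vb; have fw := fits_cap_word wa.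
have fv' := @fits_shift _ 1 0 _ _ _ isT fv; rewrite shift0 in fv'.
apply: phi_weq => m.
rewrite /glue !cap_word_rcons !level_after_rcons (flip_rcons _ fv') (flipS fv).
rewrite map_rcons cat_rcons -map_comp.
rewrite (eq_map (g := fun p => a.+1 + p)); last by move=> p /=; rewrite addnS.
rewrite !caps_cat; apply: weq_catl.
have -> : a + (1 + level_after 0 v - 2 - (level_after 0 v).-1) = a by lia.
rewrite -[in iota 0 _.+1]addn1 iotaD rev_cat add0n -[a :: _]cat1s !caps_cat !catA.
apply: weq_catr.
have := @weq_interchange _ P
  (height m (caps (box P) [seq a.+1 + i | i <- flip b (cap_word 0 v)]))
  _ _ _ [:: (Cap, 0)] fw.
by rewrite /= !addn0; exact.
Qed.

(** A moved point that was capped on the left becomes a through string on the right, and the word is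
    unchanged; one that was a through string becomes capped on the right. *)
Lemma sum_glueS a b :
  (\sum_(w <- ballots a.+1) \sum_(v <- ballots b | level_after 0 w == level_after 0 v)
     phi (glue a.+1 b w v) =
   \sum_(w <- ballots a) \sum_(v <- ballots b.+1 | level_after 0 w == level_after 0 v)
     phi (glue a b.+1 w v))%R.
Proof.
rewrite big_ballotsS [LHS]big_seq [RHS]big_seq; apply: eq_bigr => w wa.
rewrite !(big_mkcond (fun v => _ == _)) /= big_ballotsS.
rewrite (_ : (if _ then _ else _) = (\sum_(v <- ballots b) if (level_after 0 w != 0) &&
    ((level_after 0 w).-1 == level_after 0 v)
    then phi (glue a.+1 b (rcons w true) v) else 0)%R);
  last first.
  rewrite level_after_rcons; by case: eqP => // _; rewrite big1.
rewrite -big_split [LHS]big_seq [RHS]big_seq; apply: eq_bigr => v vb /=.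
rewrite !level_after_rcons [LHS]addrC; congr (_ + _)%R.
  rewrite (_ : (level_after 0 w != 0) && _ = (level_after 0 w == (level_after 0 v).+1)).
    case: eqP => // wv; congr phi; rewrite glueS_left // /glue cap_word_rcons.
    by rewrite wv -[in iota 0 _.+1]addn1 iotaD rev_cat.
  by lia.
(* At height 0 neither side has a term: [v] admits no down step, and no through string matches the
   last point of the left word. *)
have [v0|v0] := eqVneq (level_after 0 v) 0; first by rewrite v0.
rewrite (_ : (_.+1 == _) = (level_after 0 w == (level_after 0 v).-1)); last by lia.
by case: eqP => // wv; apply: phi_glue_close; rewrite ?lt0n.
Qed.

Lemma sum_glue a b :
  (\sum_(w <- ballots a) \sum_(v <- ballots b | level_after 0 w == level_after 0 v)
     phi (glue a b w v) =
   \sum_(w <- ballots (a + b) | level_after 0 w == 0%N) phi (cap_word 0 w))%R.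
Proof.
elim: b a => [|b IHb] a; last by rewrite -sum_glueS IHb addSnnS.
rewrite addn0 [RHS]big_mkcond; apply: eq_bigr => w _.
rewrite big_mkcond big_seq1 /=; case: eqP => // w0.
by rewrite /glue w0 /= cats0.
Qed.

End Gluing.

(** * The inner products *)

Section Substitution.
Variables (C : numClosedFieldType) (P : planar_algebra C).
Local Open Scope nat_scope.

Lemma all_shading_caps s ps :
  all (fun ei => shading_ok s ei.1 ei.2) (caps (box P) ps).
Proof. by rewrite all_map; apply/allP. Qed.

(** Composition without assuming the outer word legal: if it is not, the substituted word is not
    legal either, and both values are 0. *)
Lemma Z_insert s n w1 w2 (v : word (box P)) i t m :
  tangle t m v -> t = s (+) odd i -> i <= height 0 w1 ->
  Z s n (w1 ++ (Box (Z t m v), i) :: w2) = Z s n (w1 ++ shift i v ++ w2).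
Proof.
move=> tv ts iw1; have [T|nT] := boolP (tangle s n (w1 ++ (Box (Z t m v), i) :: w2)).
  exact: Z_subst.
rewrite [LHS]Z_default // [RHS]Z_default //; apply: contra nT.
have fv : fits 0 v m.*2 by move: tv; rewrite /tangle stackE => /andP[].
have := fits_shift iw1 fv; rewrite addn0 => fv'.
rewrite /tangle !stackE !fits_cat !all_cat (fits_height fv') /= addn0 iw1 subn0.
by case/andP=> /andP[-> /andP[_ ->]] /and3P[-> _ ->]; rewrite ts eqxx.
Qed.

Lemma tangle_box_caps s n m k (x : box P s n) ps :
  fits n.*2 (shift k (caps (box P) ps)) m.*2 ->
  tangle s m ((Box x, 0) :: shift k (caps (box P) ps)).
Proof.
move=> f; rewrite /tangle stackE /= addbF eqxx /= f /=.
by rewrite shift_caps all_shading_caps.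
Qed.

Lemma Z_add s n (w1 w2 : word (box P)) i t m (x y : box P t m) :
  Z s n (w1 ++ (Box (x + y)%R, i) :: w2) =
  (Z s n (w1 ++ (Box x, i) :: w2) + Z s n (w1 ++ (Box y, i) :: w2))%R.
Proof. by have := Z_linear s n w1 w2 i 1%R x y; rewrite !scale1r. Qed.

End Substitution.

(** * Reflection, juxtaposition and comparison of the two forms *)

Section GradedForms.
Variables (C : numClosedFieldType) (P : subfactor_planar_algebra C) (k : nat).
Local Notation caps := (caps (box P)).
Local Open Scope nat_scope.

Lemma star_add s n (x y : box P s n) : star (x + y)%R = (star x + star y)%R.
Proof. by have := star_antilinear (1 : C) x y; rewrite rmorph1 !scale1r. Qed.

Lemma starP_add n (x y : P_ P k n) : starP (x + y)%R = (starP x + starP y)%R.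
Proof. by rewrite /starP star_add; exact: Z_add. Qed.

Lemma scalar_add s (x y : box P s 0) :
  Defs.scalar (x + y)%R = (Defs.scalar x + Defs.scalar y)%R.
Proof. exact: linearD. Qed.

Lemma tangle_starP n (x : P_ P k n) :
  tangle false (n + k) (ncups 0 n.*2 ++ bent_box (star x) n.*2 n.*2 k.*2 : word (box P)).
Proof.
rewrite /tangle stackE; apply/andP; split.
  apply: fits_trans (fits_ncups (box P) n.*2 (leqnn 0)) _; rewrite /= !addn0 subn0.
  apply/andP; split; first by lia.
  rewrite (_ : _ + _ = (n + k).*2 + n.*2.*2); last by lia.
  by apply: fits_ncaps; lia.
rewrite all_cat /= odd_double eqxx /=; apply/andP; split.
  by rewrite all_map; apply/allP.
by rewrite all_map; apply/allP.
Qed.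

(** Reflection leaves the mirrored caps on the last strings of [star y]; the rotation in [starP]
    carries them around the box to the top left. *)
Lemma starP_caps n j (y : P_ P k n) ps : fits n.*2 (caps ps) j.*2 ->
  starP (Z false (j + k) ((Box y, 0) :: caps ps) : P_ P k j) =
  Z false (j + k) ((Box (starP y), 0) :: caps (flip n.*2 ps)).
Proof.
move=> fps.
have fits_k : fits (n + k).*2 (caps ps) (j + k).*2.
  have := @fits_shift _ k.*2 0 _ _ _ (leq0n _) fps.
  by rewrite shift0 !doubleD ![k.*2 + _]addnC.
have tangle_y : tangle false (j + k) ((Box y, 0) :: caps ps).
  by rewrite -[caps ps]shift0; apply: tangle_box_caps; rewrite shift0.
have fits_kflip : fits (n + k).*2 (shift k.*2 (caps (flip n.*2 ps))) (j + k).*2.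
  rewrite !doubleD ![_ + k.*2]addnC; apply: fits_shift => //; exact: fits_flip.
rewrite /starP star_Z // [mirror _ _ _]/= !sub0n add0n doubleD (mirror_flip _ _ fps).
rewrite /bent_box Z_insert; last 3 first.
- exact: tangle_box_caps.
- by rewrite /= odd_double.
- by rewrite (fits_height (fits_ncups _ _ (leqnn 0))); lia.
(* After reflection the side strings come first and the top strings last. *)
have fv : fits 0 ([:: (Box (star y), 0)] : word (box P)) (k.*2 + n.*2) by rewrite /=; lia.
have turn := weq_caps_turn fv (fits_flip fps).
have := turn false (j + k) [::] [::] erefl; rewrite !cat0s !cats0 => ->.
rewrite -(cat0s ((Box _, 0) :: _)) (@Z_insert _ _ _ _ [::]) ?tangle_starP //.
by rewrite shift0 cat0s -!catA /= addn0.
Qed.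

(** The caps on each box are exchanged with the levels drawn beside them and collected above both
    boxes, in the order required by [glue]. *)
Lemma side_by_side_caps m n j (x : P_ P k m) (y : P_ P k n) ps qs :
  fits m.*2 (caps ps) j.*2 -> fits n.*2 (caps qs) j.*2 ->
  Z false 0 (side_by_side (Z false (j + k) ((Box x, 0) :: caps ps) : P_ P k j)
                          (Z false (j + k) ((Box y, 0) :: caps qs) : P_ P k j)
             ++ ncaps 0 j.*2) =
  Z false 0 (side_by_side x y ++
    caps ([seq m.*2 + q | q <- qs] ++ ps ++ rev (iota 0 j.*2))).
Proof.
move=> fps fqs.
have tangle_caps i (z : P_ P k i) rs : fits i.*2 (caps rs) j.*2 ->
    tangle false (j + k) ((Box z, 0) :: caps rs).
  move=> frs; rewrite -[caps rs]shift0; apply: tangle_box_caps; rewrite !doubleD.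
  by rewrite ![_ + k.*2]addnC; apply: fits_shift.
have insert_x := @Z_insert _ _ _ _ _ _ _ _ _ _ (tangle_caps _ x _ fps).
have insert_y := @Z_insert _ _ _ _ _ _ _ _ _ _ (tangle_caps _ y _ fqs).
rewrite /side_by_side /bent_box -!catA /= insert_x //.
rewrite shift0 (catA (ncups 0 k.*2)) (catA _ (ncaps _ _)) insert_y.
- pose u : word (box P) := shift m.*2 (caps qs).
  pose v : word (box P) := ncaps 0 k.*2 ++ ((Box y, 0) :: caps qs) ++ ncaps j.*2 k.*2.
  (* [v] holds the bent sides of [x] and all of [y]; the caps on [x] rise past it. *)
  have step1 h : weq h (caps ps ++ shift j.*2 v) (shift m.*2 v ++ caps ps).
    exact: weq_interchange.
  (* The caps on [y] rise past its bent sides. *)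
  have step2 h : weq h (u ++ ncaps (m.*2 + j.*2) k.*2) (ncaps (m.*2 + n.*2) k.*2 ++ u).
    have fu : fits (m.*2 + n.*2) u (m.*2 + j.*2) by apply: fits_shift.
    by have := @weq_interchange _ P h _ _ _ (ncaps 0 k.*2) fu; rewrite !shift_ncaps !addn0.
  pose pre : word (box P) := ncups 0 k.*2 ++ [:: (Box x, 0)].
  pose mid : word (box P) := ncaps m.*2 k.*2 ++ [:: (Box y, m.*2)].
  have closing : ncaps 0 j.*2 = caps (rev (iota 0 j.*2)) by [].
  pose fin : word (box P) := caps ps ++ ncaps 0 j.*2.
  have W : weq 0 (pre ++ (caps ps ++ shift j.*2 v) ++ ncaps 0 j.*2)
                 (pre ++ mid ++ (ncaps (m.*2 + n.*2) k.*2 ++ u) ++ fin).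
    apply: weq_trans; first by apply: weq_catl; apply: weq_catr.
    rewrite -(catA (shift m.*2 v)) -/fin.
    have -> : shift m.*2 v ++ fin = mid ++ (u ++ ncaps (m.*2 + j.*2) k.*2) ++ fin.
      by rewrite /v !shift_cat !shift_ncaps addn0 -!catA /= addn0.
    by do 2!apply: weq_catl; apply: weq_catr.
  have := W false 0 [::] [::] erefl; rewrite !cat0s !cats0.
  rewrite /pre /mid /fin /v /u !shift_cat !shift_ncaps shift_caps !caps_cat -closing.
  by rewrite !addn0 !add0n -!catA /= => ->.
- by rewrite odd_double.
- have f1 : fits 0 (ncups 0 k.*2 : word (box P)) (k.*2.*2) := fits_ncups _ _ (leqnn 0).
  have f2 := @fits_shift _ (k.*2.*2 + k.*2) 0 _ _ _ (leq0n _) fps.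
  have f3 := @fits_ncaps (box P) (k.*2 + j.*2) j.*2 k.*2 (leq_addl _ _).
  rewrite !height_cat (fits_height f1) /= subn0 add0n.
  rewrite (_ : _ + _ = k.*2.*2 + k.*2 + m.*2); last by lia.
  rewrite -[caps ps]shift0 (fits_height f2).
  rewrite (_ : _ + _ = k.*2 + j.*2 + k.*2.*2); last by lia.
  by rewrite (fits_height f3); lia.
Qed.

Lemma big_additive (U W : zmodType) (f : U -> W) (I : Type) (r : seq I)
    (Q : pred I) (F : I -> U) :
  (forall x y, f (x + y) = f x + f y)%R ->
  (f (\sum_(i <- r | Q i) F i) = \sum_(i <- r | Q i) f (F i))%R.
Proof.
move=> fD; apply: big_morph => //.
by apply: (@addrI _ (f 0)%R); rewrite -fD !addr0.
Qed.

Lemma ip_addl n (z x y : P_ P k n) : (ip_ (x + y) z = ip_ x z + ip_ y z)%R.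
Proof.
rewrite /ip_ /side_by_side /bent_box -mulrDr -scalar_add -!catA /=.
by rewrite Z_add.
Qed.

Lemma ip_addr n (z x y : P_ P k n) : (ip_ z (x + y) = ip_ z x + ip_ z y)%R.
Proof.
rewrite /ip_ starP_add /side_by_side /bent_box -mulrDr -scalar_add.
by rewrite !(catA (ncups 0 k.*2)) -!(catA (_ ++ _)) /= Z_add.
Qed.

Lemma ip_0l n (y : P_ P k n) : (ip_ 0 y = 0)%R.
Proof. by apply: (@addrI _ (ip_ 0 y)%R); rewrite -ip_addl !addr0. Qed.

Lemma ip_0r n (y : P_ P k n) : (ip_ y 0 = 0)%R.
Proof. by apply: (@addrI _ (ip_ y 0)%R); rewrite -ip_addr !addr0. Qed.

Section Key.
Variables (m n : nat) (x : P_ P k m) (y : P_ P k n).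

Definition closure (ps : seq nat) : C :=
  Defs.scalar (Z false 0 (side_by_side x (starP y) ++ caps ps)).

Lemma ip_TL_map j (f : TL m.*2 j.*2) (g : TL n.*2 j.*2) : epi f -> epi g ->
  ip_ (TL_map f x) (TL_map g y) =
  ((delta P) ^- k * closure (glue m.*2 n.*2 (ballot_of f) (ballot_of g)))%R.
Proof.
move=> fe ge; have [fw fl] := ballot_of_epi fe; have [gw gl] := ballot_of_epi ge.
have := fits_cap_word P fw; rewrite fl => ff.
have := fits_cap_word P gw; rewrite gl => fg.
rewrite /ip_ /TL_map !TL_word_epi // starP_caps // side_by_side_caps //.
  by rewrite /closure /glue fl.
exact: fits_flip.
Qed.

Lemma ip_X_block j :
  (ip_ (X_block j x) (X_block j y) = (delta P) ^- k *
   \sum_(w <- ballots m.*2 | level_after 0 w == j.*2)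
     \sum_(v <- ballots n.*2 | level_after 0 v == j.*2)
       closure (glue m.*2 n.*2 w v))%R.
Proof.
rewrite /X_block (big_additive _ _ _ (ip_addl _)) mulr_sumr.
rewrite -(big_epi_ballots _ _ (fun w => (delta P ^- k *
  \sum_(v <- ballots n.*2 | level_after 0 v == j.*2) closure (glue m.*2 n.*2 w v))%R)).
apply: eq_bigr => f fe; rewrite (big_additive _ _ _ (ip_addr _)) mulr_sumr.
rewrite -(big_epi_ballots _ _ (fun v => (delta P ^- k *
  closure (glue m.*2 n.*2 (ballot_of f) v))%R)).
by apply: eq_bigr => g ge; exact: ip_TL_map.
Qed.

(** The index [j] sorts the pairings by their [2j] strings between the two groups of points. This
    number is even and at most [2m], so each pairing is met for exactly one [j < J]. *)
Lemma iipE_ip J : m < J ->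
  (iip_ x y = \sum_(j < J) ip_ (X_block j x) (X_block j y))%R.
Proof.
move=> mJ.
rewrite [RHS](eq_bigr _ (fun (j : 'I_J) _ => ip_X_block j)) -mulr_sumr.
rewrite /iip_; congr (_ * _)%R.
rewrite (eq_bigl (@epi _ _)); last by move=> f; rewrite epi_top0.
rewrite (eq_bigr (fun f => closure (cap_word 0 (ballot_of f)))); last first.
  by move=> f fe; rewrite TL_word_epi.
rewrite (big_epi_ballots _ _ (fun w => closure (cap_word 0 w))) doubleD.
(* The pairings are cut after the first [2m] points. *)
rewrite -(sum_glue (P := P)); last first.
  move=> ps qs pq; congr Defs.scalar.
  by rewrite -[X in Z _ _ X]cats0 -catA (pq _ _ _ _ _ erefl) catA cats0.
under [RHS]eq_bigr => j _ do rewrite big_mkcond /=.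
rewrite [RHS]exchange_big /= [LHS]big_seq [RHS]big_seq; apply: eq_bigr => w wm.
have lw := level_after_leq wm.
have ow := odd_fits (fits_cap_word P wm); rewrite odd_double in ow.
have wE : level_after 0 w = (level_after 0 w)./2.*2 by rewrite -[LHS]odd_double_half -ow.
have wJ : (level_after 0 w)./2 < J by lia.
rewrite (bigD1 (Ordinal wJ)) //= -wE eqxx [X in (_ + X)%R]big1 ?addr0 => [|i ni].
  by apply: eq_bigl => v; rewrite eq_sym.
case: eqP => // wi; case/eqP: ni; apply: val_inj; rewrite /= wi; lia.
Qed.

End Key.

Lemma iip_0l m n (y : P_ P k n) : (iip_ (0 : P_ P k m) y = 0)%R.
Proof. by rewrite (@iipE_ip _ _ _ _ m.+1) // big1 // => j _; rewrite X_block0 ip_0l. Qed.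

Lemma iip_0r m n (x : P_ P k m) : (iip_ x (0 : P_ P k n) = 0)%R.
Proof. by rewrite (@iipE_ip _ _ _ _ m.+1) // big1 // => j _; rewrite X_block0 ip_0r. Qed.

Lemma X_summandE (a : dsum (P_ P k)) N j :
  (forall i, N <= i -> a i = 0%R) ->
  (X_summand a j = \sum_(i < N) X_block j (a i))%R.
Proof.
by move=> aN; apply: fsum_bounded => i /aN ->; rewrite X_block0.
Qed.

Lemma iip_eq_ip_X (a b : dsum (P_ P k)) : iip a b = ip (X a) (X b).
Proof.
have [N1 aN1] := dsum_finite a; have [N2 bN2] := dsum_finite b.
pose N := maxn N1 N2.
have aN i : N <= i -> a i = 0%R by rewrite geq_max => /andP[/aN1].
have bN i : N <= i -> b i = 0%R by rewrite geq_max => /andP[_ /bN2].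
(* [X] never raises the degree, so the bound for [a] also serves for [X a]. *)
have XaN j : N <= j -> X a j = 0%R.
  move=> Nj; rewrite /= (X_summandE _ aN) big1 // => i _.
  by rewrite X_block_lt // (leq_trans _ Nj).
rewrite /iip (fsum_bounded (N := N)); last first.
  by move=> i /aN ->; rewrite fsbigop.fsbig1 // => n _; rewrite iip_0l.
rewrite /ip (fsum_bounded (N := N)); last by move=> j /XaN ->; rewrite ip_0l.
transitivity (\sum_(m < N) \sum_(n < N) \sum_(j < N)
    ip_ (X_block j (a m)) (X_block j (b n)))%R.
  apply: eq_bigr => m _; rewrite (fsum_bounded (N := N)).
    by apply: eq_bigr => n _; exact: iipE_ip.
  by move=> i /bN ->; rewrite iip_0r.
under eq_bigr => m _ do rewrite exchange_big /=.
rewrite exchange_big /=; apply: eq_bigr => j _.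
rewrite (X_summandE _ aN) (X_summandE _ bN) (big_additive _ _ _ (ip_addl _)).
by apply: eq_bigr => m _; rewrite (big_additive _ _ _ (ip_addr _)).
Qed.

End GradedForms.

Theorem lemma5p3 (R : realType) (P : subfactor_planar_algebra R[i]) (k : nat)
    (a b : dsum (P_ P k)) :
  iip a b = ip (X a) (X b).
Proof. exact: iip_eq_ip_X. Qed.
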